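(* Let $\beta\in(0,1/2^{|S|})$ and $\varepsilon\in\left(0,\frac{\beta(1-\beta)}{L\,|S|^{4}}\right)$, let $q$ be an irreducible transition matrix on $S$ and $\widehat q$ a transition matrix that is $(\varepsilon,\beta)$-close to $q$, and set $c=2|S|^2$. Then for every nonempty $C\subsetneq S$: (1) for every $s\in C$, $\max_{t\notin C}\left|\mathbf Q_{s,q}(t\mid C)-\mathbf Q_{s,\widehat q}(t\mid C)\right|<12\beta L$; (2) $\frac1c K_C\le \widehat K_C\le cK_C$.
   Context: $S$ is a finite set with $|S|\ge 2$. A transition matrix on $S$ is $q=(q(t\mid s))_{s,t\in S}$ with nonnegative entries and rows summing to $1$; $q(D\mid s)=\sum_{t\in D}q(t\mid s)$, $\overline C=S\setminus C$. For irreducible $q$, $\mu$ is its stationary distribution. $\zeta_q=\min_{\emptyset\neq C\subsetneq S}\sum_{s\in C}\mu_s q(\overline C\mid s)$. Given $\varepsilon,\beta>0$, $\widehat q$ is $(\varepsilon,\beta)$-close to $q$ if for all $s,t\in S$, $\left|1-\frac{\widehat q(t\mid s)}{q(t\mid s)}\right|\le\beta$ whenever (a) $\mu_s q(t\mid s)\ge\varepsilon\zeta_q$ or (b) $\mu_s\widehat q(t\mid s)\ge\varepsilon\zeta_q$ (in case (b) this requires $q(t\mid s)>0$). $L=\sum_{n=1}^{|S|-1}\binom{|S|}{n}n^{|S|}$. Let $(\mathbf s_n)_{n\ge0}$ be a Markov chain with transition matrix $q$, $\mathbf P_{s,q}$, $\mathbf E_{s,q}$ its law and expectation when $\mathbf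 s_0=s$; $T_D=\min\{n\ge0:\mathbf s_n\in D\}$. The exit distribution is $\mathbf Q_{s,q}(t\mid C)=\mathbf P_{s,q}(T_{\overline C}=T_{\{t\}})$ for $t\notin C$. For $s\in C$ let $\nu_C(s)=\frac{\sum_{t\in\overline C}\mu_t q(s\mid t)}{\sum_{t\in\overline C}\mu_t q(C\mid t)}$ and $K_C=\sum_{s\in C}\nu_C(s)\,\mathbf E_{s,q}[T_{\overline C}]$ (the average length of a visit to $C$). The quantities $\mathbf Q_{s,\widehat q}$, $\widehat K_C$ are defined in the same way with $\widehat q$ and its stationary distribution $\widehat\mu$ in place of $q$, $\mu$ ($\widehat q$ is irreducible under these hypotheses). *)

(* Defs.v *)
From HB Require Import structures.
From mathcomp Require Import all_boot all_order all_algebra.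
From mathcomp Require Import all_classical all_reals all_analysis.
Set Implicit Arguments. Unset Strict Implicit. Unset Printing Implicit Defensive.
Import Order.TTheory GRing.Theory Num.Theory.
Local Open Scope ring_scope.

Section Defs.
Variables (R : realType) (S : finType).

(* Convention: a transition matrix is q : S -> S -> R with  q s t = q(t | s). *)
Definition trans_mx (q : S -> S -> R) : Prop :=
  (forall s t, 0 <= q s t) /\ (forall s, \sum_(t : S) q s t = 1).

Fixpoint qpow (q : S -> S -> R) (n : nat) (s t : S) : R :=
  match n with
  | 0 => (s == t)%:R
  | n'.+1 => \sum_(u : S) q s u * qpow q n' u t
  end.

Definition irreducible (q : S -> S -> R) : Prop :=
  forall s t, exists n, 0 < qpow q n s t.

Definition stationary (q : S -> S -> R) (mu : S -> R) : Prop :=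
  (forall s, 0 <= mu s) /\ \sum_(s : S) mu s = 1 /\
  (forall t, \sum_(s : S) mu s * q s t = mu t).

Definition qset (q : S -> S -> R) (D : {set S}) (s : S) : R :=
  \sum_(t in D) q s t.

Definition zeta (q : S -> S -> R) (mu : S -> R) : \bar R :=
  \big[Order.min/+oo%E]_(C : {set S} | (C != finset.set0) && (C != [set: S]))
     (\sum_(s in C) mu s * qset q (~: C) s)%:E.

Definition eb_close (eps beta : R) (q qh : S -> S -> R) (mu : S -> R) : Prop :=
  forall s t,
    ((eps%:E * zeta q mu <= (mu s * q s t)%:E)%E \/
     (eps%:E * zeta q mu <= (mu s * qh s t)%:E)%E) ->
    0 < q s t /\ `|1 - qh s t / q s t| <= beta.

Definition Lconst : nat :=
  \sum_(1 <= n < #|S|) 'C(#|S|, n) * n ^ #|S|.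

(* pathC q C n s u = P_{s,q}(s_0, ..., s_{n-1} in C, s_n = u) *)
Fixpoint pathC (q : S -> S -> R) (C : {set S}) (n : nat) (s u : S) : R :=
  match n with
  | 0 => (s == u)%:R
  | n'.+1 => (s \in C)%:R * \sum_(v : S) q s v * pathC q C n' v u
  end.

(* Exit distribution Q_{s,q}(t | C) = P_{s,q}(T_{C^c} = T_{t}), t not in C:
   sum over n of P(T_{C^c} = n, s_n = t). *)
Definition exitQ (q : S -> S -> R) (C : {set S}) (s t : S) : \bar R :=
  (\sum_(n <oo) (pathC q C n s t)%:E)%E.

(* E_{s,q}[T_{C^c}] = sum_{n>=0} P_{s,q}(T_{C^c} > n)
                    = sum_{n>=0} P_{s,q}(s_0, ..., s_n in C). *)
Definition exitT (q : S -> S -> R) (C : {set S}) (s : S) : \bar R :=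
  (\sum_(n <oo) (\sum_(u in C) pathC q C n s u)%:E)%E.

Definition nuC (q : S -> S -> R) (mu : S -> R) (C : {set S}) (s : S) : R :=
  (\sum_(t in ~: C) mu t * q t s) / (\sum_(t in ~: C) mu t * qset q C t).

Definition KC (q : S -> S -> R) (mu : S -> R) (C : {set S}) : \bar R :=
  (\sum_(s in C) (nuC q mu C s)%:E * exitT q C s)%E.

End Defs.

(* Main.v *)
(** Replace the rows of [q] by those of [qh] one at a time.  Let [h] be the
    probability of hitting [w] before a set [B].  Growing the superlevel sets of
    [h] one state at a time and comparing with the stationary flow across each
    of them, the escape rate [mu w * P_w(reach B before returning to w)] is at
    least [zeta / #|S|].  Hence the transitions out of a row that closeness does
    not control, whose stationary flow is below [eps * zeta], carry a negligible
    share of any escape, and replacing the row of [w] acts on the escape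
    probabilities from [w] like a multiplicative error [1 +- gam] with
    [gam = 3/2 beta].  Since [mu v / mu w] is a quotient of two escape
    probabilities of which only one depends on the row of [w], each replacement
    changes the stationary measure by a factor in [1 - gam, 1 + gam] up to
    normalisation, and it moves exit probabilities by at most
    [gam / (1 - gam)].  This gives (1) after [#|S|] replacements, and (2)
    because [K_C] is the stationary mass of [C] over the stationary flow out
    of [C]. *)

Require Import Defs.
From HB Require Import structures.
From mathcomp Require Import all_boot all_order all_algebra.
From mathcomp Require Import all_classical all_reals all_analysis.
From mathcomp Require Import ring lra zify.
Set Implicit Arguments. Unset Strict Implicit. Unset Printing Implicit Defensive.
Import Order.TTheory GRing.Theory Num.Theory.
Import numFieldNormedType.Exports.
Local Open Scope ring_scope.

Section Chains.
Variables (R : realType) (S : finType).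
Implicit Types (M : S -> S -> R) (m f g h : S -> R) (A B C D : {set S}).

(** * Maximum principle, Dirichlet problem, invariant measures *)

Definition avg M f s : R := \sum_t M s t * f t.

(** Irreducibility stated through cuts: the maximum principle uses it in this form, and flow
    estimates carry it over to modified matrices. *)
Definition edge_connected M := forall A a b, a \in A -> b \notin A ->
  exists s t, [/\ s \in A, t \notin A & 0 < M s t].

Definition invariant_measure M m := forall t, \sum_s m s * M s t = m t.

Definition flow m M A : R := \sum_(s in A) \sum_(t | t \notin A) m s * M s t.

Lemma irreducible_connected M : trans_mx M -> irreducible M -> edge_connected M.
Proof.
move=> [M0 _] irrM A a b aA bA; apply: contrapT => noedge.
have M_out s t : s \in A -> t \notin A -> M s t = 0.
  move=> sA tA; apply/eqP; rewrite eq_le M0 andbT leNgt; apply/negP => Mst.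
  by apply: noedge; exists s, t.
have [n] := irrM a b; suff -> : qpow M n a b = 0 by rewrite ltxx.
elim: n a aA => [|n IHn] a aA /=.
  by rewrite (_ : (a == b) = false) //; apply/eqP => ab; rewrite -ab aA in bA.
apply: big1 => u _; have [uA|uA] := boolP (u \in A); first by rewrite IHn // mulr0.
by rewrite M_out // mul0r.
Qed.

Lemma avgB M f g s : avg M (fun t => f t - g t) s = avg M f s - avg M g s.
Proof. by rewrite /avg -sumrB; apply: eq_bigr => t _; rewrite mulrBr. Qed.

Lemma avgZ M a f s : avg M (fun t => a * f t) s = a * avg M f s.
Proof. by rewrite /avg mulr_sumr; apply: eq_bigr => t _; rewrite mulrCA. Qed.

Lemma avg_cst M a s : trans_mx M -> avg M (fun=> a) s = a.
Proof. by move=> [_ M1]; rewrite /avg -mulr_suml M1 mul1r. Qed.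

Lemma avg_le M f g s : trans_mx M -> (forall t, f t <= g t) ->
  avg M f s <= avg M g s.
Proof. by move=> [M0 _] fg; apply: ler_sum => t _; apply: ler_wpM2l. Qed.

(** A positive maximum could only be attained inside [D]. The set [A] of maximisers misses [b], so
    some transition leads from a state of [A] to a smaller value, and at that state the average
    falls strictly below the maximum. *)
Lemma max_principle M D f b : trans_mx M -> edge_connected M -> b \notin D ->
  (forall s, s \in D -> f s <= avg M f s) ->
  (forall s, s \notin D -> f s <= 0) -> forall s, f s <= 0.
Proof.
move=> [M0 M1] connM bD fD fND s.
have [x _ fx] := @arg_maxP _ _ _ b xpredT f isT.
have {}fx y : f y <= f x by exact: fx.
apply: le_trans (fx s) _; rewrite leNgt; apply/negP => fx0.
pose A := [set y | f y == f x]%SET.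
have AD y : y \in A -> y \in D.
  rewrite finset.inE => /eqP fy; apply: contraLR fx0 => yD.
  by rewrite -fy -leNgt fND.
have bA : b \notin A by apply: contra bD; exact: AD.
have xA : x \in A by rewrite finset.inE.
have [y [z [yA zA Myz]]] := connM A x b xA bA.
have := fD _ (AD _ yA); apply/negP; rewrite -ltNge.
move: yA zA; rewrite !finset.inE => /eqP -> zA.
rewrite -[ltRHS]mul1r -(M1 y) mulr_suml /avg (bigD1 z) //= [ltRHS](bigD1 z) //=.
apply: ltr_leD; last by apply: ler_sum => t _; rewrite ler_wpM2l.
by rewrite ltr_pM2l // lt_neqAle zA fx.
Qed.

Lemma dirichlet_unique M D f g b : trans_mx M -> edge_connected M -> b \notin D ->
  (forall s, s \in D -> f s - avg M f s = g s - avg M g s) ->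
  (forall s, s \notin D -> f s = g s) -> f =1 g.
Proof.
move=> tM cM bD fgD fgND s; apply/eqP; rewrite eq_le -subr_le0 -[X in _ && X]subr_le0.
apply/andP; split.
  apply: (max_principle (f := fun s => f s - g s) tM cM bD) => t tD.
    by rewrite avgB; have := fgD _ tD; lra.
  by rewrite fgND // subrr.
apply: (max_principle (f := fun s => g s - f s) tM cM bD) => t tD.
  by rewrite avgB; have := fgD _ tD; lra.
by rewrite fgND // subrr.
Qed.

(** Uniqueness makes the matrix [P] of the linear system injective, hence invertible. The single
    function [g] gives both the source on [D] and the boundary values off [D]. *)
Lemma dirichlet_exists M D g b : trans_mx M -> edge_connected M -> b \notin D ->
  exists f, (forall s, s \in D -> f s = avg M f s + g s) /\
            (forall s, s \notin D -> f s = g s).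
Proof.
move=> tM cM bD; pose n := #|S|.
pose P : 'M[R]_n := \matrix_(j, i) ((i == j)%:R
   - (enum_val i \in D)%:R * M (enum_val i) (enum_val j)).
have vP (v : 'rV[R]_n) (f := fun s => v 0 (enum_rank s)) s :
    (v *m P) 0 (enum_rank s) = f s - (s \in D)%:R * avg M f s.
  rewrite !mxE (eq_bigr (fun j => v 0 j * (enum_rank s == j)%:R
      - (s \in D)%:R * (M s (enum_val j) * v 0 j))); last first.
    by move=> j _; rewrite mxE enum_rankK; ring.
  rewrite sumrB -mulr_sumr; congr (_ - _ * _).
    rewrite (bigD1 (enum_rank s)) //= eqxx mulr1 big1 ?addr0 // => j.
    by rewrite eq_sym => /negbTE ->; rewrite mulr0.
  rewrite /avg (reindex (@enum_val S S)) /=; last first.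
    by exists enum_rank => x _; rewrite ?enum_valK ?enum_rankK.
  by apply: eq_bigr => j _; rewrite /f enum_valK.
have uP : P \in unitmx.
  rewrite -row_free_unit -kermx_eq0; apply/eqP/row_matrixP => i.
  rewrite row0; set v := row i _.
  have v0 : v *m P = 0 by rewrite -row_mul mulmx_ker row0.
  pose f s := v 0 (enum_rank s).
  have fE s : f s = (s \in D)%:R * avg M f s.
    by apply/eqP; rewrite -subr_eq0 -vP v0 mxE.
  have f0 : f =1 fun=> 0.
    apply: (dirichlet_unique tM cM bD) => s sD; rewrite fE ?sD ?(negbTE sD) ?mul0r //.
    by rewrite mul1r avg_cst // !subrr.
  by apply/rowP => j; rewrite [RHS]mxE -(enum_valK j); exact: f0.
pose w : 'rV[R]_n := \row_j g (enum_val j).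
pose f s := (w *m invmx P) 0 (enum_rank s).
have fE s : f s - (s \in D)%:R * avg M f s = g s.
  by rewrite -vP mulmxKV // mxE enum_rankK.
exists f; split=> s sD; have := fE s; rewrite ?sD ?(negbTE sD) ?mul1r ?mul0r; lra.
Qed.

(** Constants lie in the kernel of the identity minus [M], so this matrix also has a nonzero left
    null vector [k]; the absolute values of [k] form the measure. *)
Lemma invariant_exists M (a : S) : trans_mx M ->
  exists2 m, invariant_measure M m & (forall s, 0 <= m s) /\ exists s, 0 < m s.
Proof.
move=> [M0 M1]; pose n := #|S|.
pose P : 'M[R]_n := \matrix_(i, j) ((i == j)%:R - M (enum_val i) (enum_val j)).
have nfree : ~~ row_free P.
  rewrite row_free_unit -unitmx_tr -row_free_unit; apply/negP => fP.
  have : const_mx 1 *m P^T = 0 *m P^T :> 'rV_n.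
    rewrite mul0mx; apply/rowP => i; rewrite !mxE.
    rewrite (eq_bigr (fun j => (i == j)%:R - M (enum_val i) (enum_val j))); last first.
      by move=> j _; rewrite !mxE mul1r.
    rewrite sumrB (bigD1 i) //= eqxx big1 ?addr0; last first.
      by move=> j; rewrite eq_sym => /negbTE ->.
    rewrite -(M1 (enum_val i)) (reindex (@enum_val S S)) /= ?subrr //.
    by exists enum_rank => x _; rewrite ?enum_valK ?enum_rankK.
  move/(row_free_inj fP)/rowP/(_ (enum_rank a)); rewrite !mxE => /eqP.
  by rewrite oner_eq0.
have [v vP v0] : exists2 v : 'rV[R]_n, v *m P = 0 & v != 0.
  move: nfree; rewrite -kermx_eq0 => /rowV0Pn[v vk v0]; exists v => //.
  by apply/sub_kermxP.
pose k s := v 0 (enum_rank s).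
have kE t : \sum_s k s * M s t = k t.
  move/rowP/(_ (enum_rank t)): vP; rewrite !mxE.
  rewrite (eq_bigr (fun j => v 0 j * (j == enum_rank t)%:R - v 0 j * M (enum_val j) t)); last first.
    by move=> j _; rewrite mxE enum_rankK mulrBr.
  rewrite sumrB (bigD1 (enum_rank t)) //= eqxx mulr1 big1 ?addr0; last first.
    by move=> j /negbTE ->; rewrite mulr0.
  move/eqP; rewrite subr_eq0 => /eqP kt; rewrite [RHS]kt.
  rewrite (reindex (@enum_val S S)) /=; last first.
    by exists enum_rank => x _; rewrite ?enum_valK ?enum_rankK.
  by apply: eq_bigr => j _; rewrite /k enum_valK.
have kle t : `|k t| <= \sum_s `|k s| * M s t.
  rewrite -{1}kE; apply: le_trans (ler_norm_sum _ _ _) _.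
  by apply: ler_sum => s _; rewrite normrM (ger0_norm (M0 _ _)).
(* Both sides of [kle] have the same total mass, so equality holds throughout. *)
have ksum : \sum_t (\sum_s `|k s| * M s t - `|k t|) = 0.
  rewrite sumrB exchange_big /= -sumrB big1 // => s _.
  by rewrite -mulr_sumr M1 mulr1 subrr.
exists (fun s => `|k s|).
  move=> t; apply/eqP; rewrite -subr_eq0; apply/eqP.
  by apply: (psumr_eq0P _ ksum) => // s _; rewrite subr_ge0.
split=> //; have /rV0Pn[j vj] := v0.
by exists (enum_val j); rewrite normr_gt0 /k enum_valK.
Qed.

(** A transition from a state of positive mass to one of zero mass would contradict invariance at
    the latter. *)
Lemma invariant_pos M m s0 : trans_mx M -> edge_connected M -> invariant_measure M m ->
  (forall s, 0 <= m s) -> 0 < m s0 -> forall s, 0 < m s.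
Proof.
move=> [M0 _] cM mM m0 ms0 s; rewrite lt_neqAle m0 andbT eq_sym; apply/negP => ms.
have [||] := cM [set x | m x != 0]%SET s0 s.
- by rewrite finset.inE gt_eqF.
- by rewrite finset.inE ms.
move=> x [y []]; rewrite !finset.inE negbK => mx /eqP my Mxy.
have /psumr_eq0P : \sum_x m x * M x y = 0 by rewrite mM.
move=> /(_ _ x isT) => /(_ (fun x _ => mulr_ge0 (m0 x) (M0 x y)))/eqP.
by rewrite mulf_eq0 (negbTE mx) gt_eqF.
Qed.

Lemma invariant_avg M m f : invariant_measure M m ->
  \sum_s m s * avg M f s = \sum_s m s * f s.
Proof.
move=> mM; under eq_bigr do rewrite /avg mulr_sumr.
rewrite exchange_big /=; apply: eq_bigr => t _; rewrite -mM mulr_suml.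
by apply: eq_bigr => s _; rewrite mulrA.
Qed.

(** * Escape rates *)

Lemma sum_memC A f : \sum_(s in A) f s + \sum_(s | s \notin A) f s = \sum_s f s.
Proof. by rewrite [RHS](bigID (mem A)). Qed.

(** Adding the flow inside [A] turns both sides into the mass of [A], one by invariance and the
    other because rows sum to 1. *)
Lemma flow_balance M m A : trans_mx M -> invariant_measure M m ->
  \sum_(s | s \notin A) \sum_(t in A) m s * M s t = flow m M A.
Proof.
move=> [_ M1] mM; rewrite /flow exchange_big /=.
apply: (@addrI _ (\sum_(t in A) \sum_(s in A) m s * M s t)).
rewrite [in RHS]exchange_big /= -!big_split /=; apply: eq_bigr => t _.
by rewrite !sum_memC mM -mulr_sumr M1 mulr1.
Qed.

(** By invariance the right-hand sum is the inflow minus the outflow of [A], each weighted by [h] at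
    the arrival state. The two flows are equal, and the arrival values differ by at least
    [a - b]. *)
Lemma flow_level_gap M m h A (a b z : R) : trans_mx M -> invariant_measure M m ->
  (forall s, 0 <= m s) -> z <= flow m M A -> b <= a ->
  (forall s, s \in A -> a <= h s) -> (forall s, s \notin A -> h s <= b) ->
  (a - b) * z <= \sum_(s in A) m s * (h s - avg M h s).
Proof.
move=> tM mM m0 zA ba hA hNA; have [M0 M1] := tM.
apply: (@le_trans _ _ ((a - b) * flow m M A)).
  by rewrite ler_wpM2l // subr_ge0.
rewrite mulrBl -{1}(flow_balance A tM mM) /flow !mulr_sumr.
have -> : \sum_(s in A) m s * (h s - avg M h s) =
    \sum_(s | s \notin A) \sum_(t in A) h t * (m s * M s t)
    - \sum_(s in A) \sum_(t | t \notin A) h t * (m s * M s t).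
  rewrite [X in _ = X - _]exchange_big /=.
  rewrite -[X in _ = X - _](addKr (\sum_(t in A) \sum_(s in A) h t * (m s * M s t))).
  rewrite -big_split /= [X in _ = - X + _ - _]exchange_big /= addrAC addrC.
  rewrite -opprD -big_split /= -sumrB; apply: eq_bigr => s _.
  rewrite !sum_memC -mulr_sumr mM mulrBr mulrC.
  congr (_ - _); rewrite /avg mulr_sumr; apply: eq_bigr => t _; ring.
apply: lerB; apply: ler_sum => s sA; rewrite mulr_sumr; apply: ler_sum => t tA.
  by rewrite ler_wpM2r ?hA ?mulr_ge0.
by rewrite ler_wpM2r ?hNA ?mulr_ge0.
Qed.

(** The conditions on [h] characterise the probability of reaching [w] before [B], without reference
    to trajectories. *)
Lemma hitting_ge0 M B h w b : trans_mx M -> edge_connected M -> b \in B -> w \notin B ->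
  h w = 1 -> (forall s, s \in B -> h s = 0) ->
  (forall s, s \notin B -> s != w -> h s = avg M h s) -> forall s, 0 <= h s.
Proof.
move=> tM cM bB wB hw hB hE s; rewrite -oppr_le0 -sub0r.
have bD : b \notin (~: B :\ w)%SET by rewrite !finset.inE bB andbF.
apply: (max_principle (f := fun t => 0 - h t) tM cM bD) => t.
  by rewrite !finset.inE => /andP[tw tB]; rewrite avgB avg_cst // -hE.
rewrite !finset.inE negb_and !negbK => /orP[/eqP ->|/hB ->]; rewrite ?hw; lra.
Qed.

Lemma hitting_le1 M B h w b : trans_mx M -> edge_connected M -> b \in B -> w \notin B ->
  h w = 1 -> (forall s, s \in B -> h s = 0) ->
  (forall s, s \notin B -> s != w -> h s = avg M h s) -> forall s, h s <= 1.
Proof.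
move=> tM cM bB wB hw hB hE s; rewrite -subr_le0.
have bD : b \notin (~: B :\ w)%SET by rewrite !finset.inE bB andbF.
apply: (max_principle (f := fun t => h t - 1) tM cM bD) => t.
  by rewrite !finset.inE => /andP[tw tB]; rewrite avgB avg_cst // -hE.
rewrite !finset.inE negb_and !negbK => /orP[/eqP ->|/hB ->]; rewrite ?hw; lra.
Qed.

(* The superlevel sets of [h] are grown one state at a time; each step loses at
   most [m w * (1 - avg M h w) / z] by [flow_level_gap], and 0 is eventually
   reached. *)
Lemma escape_lower_bound M m B h w b z : trans_mx M -> edge_connected M ->
  invariant_measure M m -> (forall s, 0 <= m s) -> 0 < z ->
  (forall A a a', a \in A -> a' \notin A -> z <= flow m M A) ->
  b \in B -> w \notin B ->
  h w = 1 -> (forall s, s \in B -> h s = 0) ->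
  (forall s, s \notin B -> s != w -> h s = avg M h s) ->
  z <= #|S|%:R * (m w * (1 - avg M h w)).
Proof.
move=> tM cM mM m0 z0 zM bB wB hw hB hE.
have h0 := hitting_ge0 tM cM bB wB hw hB hE.
have h1 := hitting_le1 tM cM bB wB hw hB hE.
set c := m w * _.
(* At [w] the summand is [c]; elsewhere it vanishes off [B], where [h] is harmonic, and is
   nonpositive on [B], where [h] is 0. *)
have hA A : w \in A -> \sum_(s in A) m s * (h s - avg M h s) <= c.
  move=> wA; rewrite (bigD1 w) //= hw -/c gerDl; apply: sumr_le0 => s /andP[_ sw].
  have [sB|sB] := boolP (s \in B); last by rewrite -hE // subrr mulr0.
  rewrite hB // sub0r mulrN oppr_le0 mulr_ge0 //.
  by apply: sumr_ge0 => t _; rewrite mulr_ge0 //; case: tM.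
(* The last clause says [h s >= 1 - k * c / z] on a superlevel set of [k + 1] states. *)
have grow k : (k < #|S|)%N -> exists A, [/\ #|A| = k.+1, w \in A,
    forall s t, s \in A -> t \notin A -> h t <= h s &
    forall s, s \in A -> z <= k%:R * c + h s * z].
  elim: k => [_|k IHk kS].
    exists [set w]%SET; rewrite cards1 finset.set11; split=> // s; last first.
      by rewrite finset.in_set1 => /eqP ->; rewrite hw mul0r add0r mul1r.
    by move=> t; rewrite !finset.in_set1 => /eqP -> _; rewrite hw h1.
  have [A [cA wA lvl hz]] := IHk (ltnW kS).
  have [x0 x0A] : exists x0, x0 \notin A.
    apply/existsP; rewrite -negb_forall; apply/negP => /forallP AT.
    have : A = [set: S]%SET by apply/setP => x; rewrite finset.inE AT.
    by move=> /(congr1 (fun X : {set S} => #|X|)); rewrite cA cardsT; lia.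
  have [x xA hx] := @arg_maxP _ _ _ x0 (fun y => y \notin A) h x0A.
  have {}hx y : y \notin A -> h y <= h x by exact: hx.
  have [a aA ha] := @arg_minP _ _ _ w (mem A) h wA.
  have {}ha y : y \in A -> h a <= h y by exact: ha.
  exists (x |: A)%SET; split.
  - by rewrite cardsU1 xA cA.
  - by rewrite finset.inE wA orbT.
  - move=> s t; rewrite !finset.inE negb_or => /orP[/eqP ->|sA] /andP[_ tA].
      exact: hx.
    exact: lvl.
  - have gap : (h a - h x) * z <= c.
      apply: le_trans (hA _ wA).
      by apply: flow_level_gap => //; [exact: zM wA x0A | exact: lvl].
    have hxz : z <= k.+1%:R * c + h x * z by have := hz _ aA; rewrite -natr1; lra.
    move=> s; rewrite !finset.inE => /orP[/eqP -> //|sA].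
    apply: le_trans hxz _; rewrite lerD2l ler_wpM2r ?(ltW z0) //.
    exact: lvl.
have S0 : (0 < #|S|)%N by apply/card_gt0P; exists w.
(* After [#|S| - 1] steps the set is all of [S], so it contains [b], where [h] vanishes. *)
have [|A [cA _ _ /(_ b)]] := grow #|S|.-1; first by rewrite prednK.
have -> : A = [set: S]%SET.
  by apply/eqP; rewrite eqEcard finset.subsetT cA prednK // cardsT leqnn.
rewrite finset.inE hB // mul0r addr0 => /(_ isT) /le_trans; apply.
rewrite ler_wpM2r ?ler_nat ?leq_pred //.
by rewrite mulr_ge0 // subr_ge0 -(avg_cst 1 w tM) avg_le.
Qed.

(** * Replacing one row *)

Lemma hitting_exists M B w b : trans_mx M -> edge_connected M -> b \in B ->
  w \notin B -> exists h, [/\ h w = 1, forall s, s \in B -> h s = 0 &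
    forall s, s \notin B -> s != w -> h s = avg M h s].
Proof.
move=> tM cM bB wB.
have bD : b \notin (~: B :\ w)%SET by rewrite !finset.inE bB andbF.
have [h [hD hND]] := dirichlet_exists (fun s => (s == w)%:R) tM cM bD.
exists h; split=> [|s sB|s sB sw].
- by rewrite hND ?eqxx // !finset.inE eqxx.
- rewrite hND; last by rewrite !finset.inE sB andbF.
  by rewrite (_ : (s == w) = false) //; apply: contraNF wB => /eqP <-.
- by rewrite hD ?(negbTE sw) ?addr0 // !finset.inE sw.
Qed.

(** One inequality for both kinds of entries: [beta] is the relative error of the controlled ones,
    [e] bounds the error of those too small to be controlled. *)
Definition row_close beta e M M' (w : S) :=
  forall x, `|M' w x - M w x| <= beta * M w x + e.

(** Keeping [g] in the multiplicative part makes that error proportional to an escape probability in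
    the uses below; only the additive part invokes [g <= 1]. *)
Lemma row_close_avg beta e M M' w f g : trans_mx M -> 0 <= beta -> 0 <= e ->
  row_close beta e M M' w -> (forall s, `|f s| <= g s <= 1) ->
  `|avg M' f w - avg M f w| <= beta * avg M g w + #|S|%:R * e.
Proof.
move=> [M0 _] beta0 e0 MM' fg.
rewrite /avg -sumrB mulr_sumr mulr_natl -sumr_const.
rewrite -big_split /=; apply: le_trans (ler_norm_sum _ _ _) _.
apply: ler_sum => x _; have /andP[fgx gx1] := fg x.
rewrite -mulrBl normrM.
apply: (@le_trans _ _ ((beta * M w x + e) * g x)).
  by apply: ler_pM.
have gx0 : 0 <= g x by apply: le_trans fgx.
by rewrite mulrDl -mulrA lerD2l ler_piMr.
Qed.

(** Let [h] be the probability of reaching [v] before [w]. Testing invariance against [h] gives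
    [m v * (1 - avg M h v) = m w * avg M h w], where [1 - avg M h v] does not see row [w]. The
    escape bound turns the change of [avg M h w] into a factor between [1 - gam] and [1 + gam]. The
    conclusion is cross-multiplied to avoid quotients. *)
Lemma row_change_invariant M M' m m' w (beta e z gam : R) :
  trans_mx M -> edge_connected M -> invariant_measure M m -> invariant_measure M' m' ->
  (forall s, 0 <= m s) -> (forall s, 0 <= m' s) -> 0 < z ->
  (forall A a a', a \in A -> a' \notin A -> z <= flow m M A) ->
  (forall s t, s != w -> M' s t = M s t) ->
  row_close beta e M M' w -> 0 <= beta <= gam -> 0 <= e ->
  #|S|%:R * (#|S|%:R * (e * m w)) <= (gam - beta) * z ->
  forall v, (1 - gam) * (m v * m' w) <= m' v * m w <= (1 + gam) * (m v * m' w).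
Proof.
move=> tM cM mM mM' m0 m'0 z0 zM MM' cl /andP[beta0 beta_gam] e0 ez v.
have [->|vw] := eqVneq v w.
  have := mulr_ge0 (le_trans beta0 beta_gam) (mulr_ge0 (m0 w) (m'0 w)); nra.
have vB : v \notin [set w]%SET by rewrite finset.in_set1.
have [h [hv hB hE]] := hitting_exists tM cM (finset.set11 w) vB.
have hw : h w = 0 by rewrite hB ?finset.set11.
(* Only [v] and [w] contribute when [k] is paired with [h - avg K h], and at [v] the rows of [K] and
   [M] agree. *)
have idn K (k : S -> R) : invariant_measure K k -> (forall s t, s != w -> K s t = M s t) ->
    k v * (1 - avg M h v) = k w * avg K h w.
  move=> kK KM; have avgE s : s != w -> avg K h s = avg M h s.
    by move=> sw; apply: eq_bigr => t _; rewrite KM.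
  have := invariant_avg h kK; move/eqP; rewrite -subr_eq0 -sumrB (bigD1 w) //=.
  rewrite (bigD1 v) //= big1 ?addr0; last first.
    by move=> s /andP[sw sv]; rewrite avgE // -hE ?subrr // finset.in_set1.
  by rewrite (avgE v) // hv hw mulr0 => /eqP; lra.
have idm := idn _ _ mM (fun s t _ => erefl).
have idm' := idn _ _ mM' MM'.
have h0 := hitting_ge0 tM cM (finset.set11 w) vB hv hB hE.
have h1 := hitting_le1 tM cM (finset.set11 w) vB hv hB hE.
have esc := escape_lower_bound tM cM mM m0 z0 zM (finset.set11 w) vB hv hB hE.
have S0 : 0 < #|S|%:R :> R by rewrite ltr0n; apply/card_gt0P; exists w.
have c0 : 0 < m v * (1 - avg M h v) by have := lt_le_trans z0 esc; rewrite pmulr_rgt0.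
have p0 : 0 < 1 - avg M h v.
  by rewrite lt0r; apply/andP; split; have := m0 v; nra.
(* By the escape bound, the additive error is at most the share [gam - beta] of the escape rate. *)
have ec : #|S|%:R * (e * m w) <= (gam - beta) * (m w * avg M h w).
  rewrite -(ler_pM2l S0) mulrCA; apply: le_trans ez _.
  by rewrite -idm mulrCA ler_wpM2l ?subr_ge0.
have hh s : `|h s| <= h s <= 1 by rewrite ger0_norm ?lexx ?h1.
have /ler_normlP[lo hi] := row_close_avg tM beta0 e0 cl hh.
have mlo : (1 - gam) * (m w * avg M h w) <= m w * avg M' h w by have := m0 w; nra.
have mhi : m w * avg M' h w <= (1 + gam) * (m w * avg M h w) by have := m0 w; nra.
rewrite -(ler_pM2r p0) -(ler_pM2r p0 (m' v * m w)); apply/andP; split.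
  have -> : (1 - gam) * (m v * m' w) * (1 - avg M h v) = m' w * ((1 - gam) * (m w * avg M h w)).
    by rewrite -idm; ring.
  have -> : m' v * m w * (1 - avg M h v) = m' w * (m w * avg M' h w).
    by rewrite mulrAC idm'; ring.
  by rewrite ler_wpM2l.
have -> : (1 + gam) * (m v * m' w) * (1 - avg M h v) = m' w * ((1 + gam) * (m w * avg M h w)).
  by rewrite -idm; ring.
have -> : m' v * m w * (1 - avg M h v) = m' w * (m w * avg M' h w).
  by rewrite mulrAC idm'; ring.
by rewrite ler_wpM2l.
Qed.

(** With [h] the probability of reaching [w] before leaving [C], [f' - f] is [(f' w - f w) * h]. At
    [w] the difference is a quotient whose numerator is at most [gam * p] and whose denominator is
    at least [(1 - gam) * p], where [p] is the escape probability; so [p] cancels. *)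
Lemma row_change_exit M M' C m f f' w b (beta e z gam : R) :
  trans_mx M -> edge_connected M -> trans_mx M' ->
  invariant_measure M m -> (forall s, 0 <= m s) -> 0 < z ->
  (forall A a a', a \in A -> a' \notin A -> z <= flow m M A) ->
  (forall s t, s != w -> M' s t = M s t) ->
  row_close beta e M M' w -> 0 <= beta <= gam -> gam < 1 -> 0 <= e ->
  #|S|%:R * (#|S|%:R * (e * m w)) <= (gam - beta) * z ->
  b \notin C ->
  (forall s, s \in C -> f s = avg M f s) -> (forall s, s \in C -> f' s = avg M' f' s) ->
  (forall s, s \notin C -> f' s = f s) -> (forall s, 0 <= f s <= 1) ->
  forall s, `|f' s - f s| <= gam / (1 - gam).
Proof.
move=> tM cM tM' mM m0 z0 zM MM' cl /andP[beta0 beta_gam] gam1 e0 ez bC fC f'C ff' f01.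
have gamq : 0 <= gam / (1 - gam).
  by rewrite divr_ge0 ?subr_ge0 ?(ltW gam1) // (le_trans beta0).
have avgE k s : s != w -> avg M' k s = avg M k s.
  by move=> sw; apply: eq_bigr => t _; rewrite MM'.
(* If [w] is outside [C], its row does not enter the Dirichlet problem and [f'] equals [f]. *)
have [wC|wC] := boolP (w \in C); last first.
  move=> s; rewrite (dirichlet_unique (f := f') (g := f) tM cM bC) ?subrr ?normr0 // => t tC.
  rewrite -fC // f'C // avgE ?subrr //; first by apply: contraNneq wC => <-.
have bB : b \in (~: C)%SET by rewrite finset.inE.
have wB : w \notin (~: C)%SET by rewrite finset.inE negbK.
have [h [hw hB hE]] := hitting_exists tM cM bB wB.
have h0 := hitting_ge0 tM cM bB wB hw hB hE.
have h1 := hitting_le1 tM cM bB wB hw hB hE.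
have esc := escape_lower_bound tM cM mM m0 z0 zM bB wB hw hB hE.
have {}hB s : s \notin C -> h s = 0 by move=> sC; rewrite hB // finset.inE.
have {}hE s : s \in C -> s != w -> h s = avg M h s.
  by move=> sC sw; rewrite -hE // finset.inE negbK.
have bD : b \notin (C :\ w)%SET by rewrite !finset.inE (negbTE bC) andbF.
have f'E s : f' s = f s - (f w - f' w) * h s.
  apply: (dirichlet_unique (g := fun s => f s - (f w - f' w) * h s) tM cM bD) => t;
    rewrite !finset.inE.
    move=> /andP[tw tC]; rewrite avgB avgZ -fC // -hE // -(avgE _ _ tw) -f'C //; lra.
  rewrite negb_and negbK => /orP[/eqP ->|tC]; first by rewrite hw; lra.
  by rewrite hB // mulr0 subr0 ff'.
(* Started at [s], the chain misses [w] with probability [1 - h s]; otherwise it restarts from [w]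
   with value [f w]. *)
have fh s : `|f s - f w| <= 1 - h s.
  rewrite ler_norml; apply/andP; split; rewrite -subr_le0.
    apply: (max_principle (f := fun s => - (1 - h s) - (f s - f w)) tM cM bD) => t;
      rewrite !finset.inE.
      move=> /andP[tw tC].
      have -> : avg M (fun s => - (1 - h s) - (f s - f w)) t =
         avg M (fun s => (h s - 1) - (f s - f w)) t by apply: eq_bigr => x _; congr (_ * _); lra.
      by rewrite !avgB !avg_cst // -fC // -hE //; lra.
    rewrite negb_and negbK => /orP[/eqP ->|tC]; first by rewrite hw; lra.
    by rewrite hB //; have := f01 w; have := f01 t; lra.
  apply: (max_principle (f := fun s => (f s - f w) - (1 - h s)) tM cM bD) => t;
    rewrite !finset.inE.
    move=> /andP[tw tC]; rewrite !avgB !avg_cst // -fC // -hE //; lra.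
  rewrite negb_and negbK => /orP[/eqP ->|tC]; first by rewrite hw; lra.
  by rewrite hB //; have := f01 w; have := f01 t; lra.
set p := 1 - avg M h w in esc *.
have S0 : 0 < #|S|%:R :> R by rewrite ltr0n; apply/card_gt0P; exists w.
have c0 : 0 < m w * p by have := lt_le_trans z0 esc; rewrite pmulr_rgt0.
have mw : 0 < m w by rewrite lt0r m0 andbT; apply: contraTneq c0 => ->; rewrite mul0r ltxx.
have p0 : 0 < p by rewrite -(pmulr_rgt0 _ mw).
have ec : #|S|%:R * e <= (gam - beta) * p.
  rewrite -(ler_pM2l mw) -(ler_pM2l S0).
  rewrite [leLHS](_ : _ = #|S|%:R * (#|S|%:R * (e * m w))); last by ring.
  apply: le_trans ez _.
  by rewrite [leRHS](_ : _ = (gam - beta) * (#|S|%:R * (m w * p))) ?ler_wpM2l ?subr_ge0 //; ring.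
have avg1h K : trans_mx K -> avg K (fun s => 1 - h s) w = 1 - avg K h w.
  by move=> tK; rewrite avgB avg_cst.
have hh s : 0 <= 1 - h s <= 1 by have := h0 s; have := h1 s; lra.
(* Subtracting the constant [f w] changes no difference of averages but allows the weight [1 - h],
   whose average is [p]. *)
have d1 : `|avg M' f w - avg M f w| <= gam * p.
  have := row_close_avg (f := fun s => f s - f w) (g := fun s => 1 - h s) tM beta0 e0 cl.
  rewrite !avgB !avg_cst // -/p => H.
  have -> : avg M' f w - avg M f w = avg M' f w - f w - (avg M f w - f w) by lra.
  apply: le_trans (H _) _ => [s|]; first by rewrite fh; case/andP: (hh s).
  by have := ec; lra.
have d2 : (1 - gam) * p <= 1 - avg M' h w.
  have := row_close_avg (f := fun s => 1 - h s) (g := fun s => 1 - h s) tM beta0 e0 cl.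
  rewrite !avg1h // -/p => /(_ _)/ler_normlP[s|lo hi]; last by have := ec; lra.
  by have /andP[x y] := hh s; rewrite ger0_norm ?lexx.
have dw : (f' w - f w) * (1 - avg M' h w) = avg M' f w - avg M f w.
  have : avg M' f' w = avg M' (fun s => f s - (f w - f' w) * h s) w.
    by apply: eq_bigr => t _; rewrite f'E.
  by rewrite -f'C // avgB avgZ -fC // => f'w; lra.
have dle : `|f' w - f w| <= gam / (1 - gam).
  rewrite ler_pdivlMr ?subr_gt0 // -(ler_pM2r p0); apply: le_trans d1.
  rewrite -dw normrM -mulrA ler_wpM2l // (le_trans d2) // ler_norm //.
move=> s; rewrite f'E (_ : _ - _ - _ = (f' w - f w) * h s); last by lra.
by rewrite normrM (ger0_norm (h0 s)); apply: le_trans dle; rewrite ler_piMr.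
Qed.

(** * Exit distributions and visit lengths *)

(** The partial sums increase and stay below [f], so they converge; their recursion passes to the
    limit, which then solves the same Dirichlet problem as [f]. Exit distributions and exit times
    are the cases where [g] is the indicator of [t] and of [C]. *)
Lemma killed_series M C f g b (a : nat -> S -> R) :
  trans_mx M -> edge_connected M -> b \notin C -> (forall s, 0 <= g s) ->
  a 0%N =1 g -> (forall n s, a n.+1 s = (s \in C)%:R * avg M (a n) s) ->
  (forall s, s \in C -> f s = avg M f s + g s) ->
  (forall s, s \notin C -> f s = g s) ->
  forall s, (\sum_(n <oo) (a n s)%:E)%E = (f s)%:E.
Proof.
move=> tM cM bC g0 a0 aS fC fNC; have [M0 _] := tM.
have age0 n s : 0 <= a n s.
  elim: n s => [|n IHn] s; first by rewrite a0.
  by rewrite aS mulr_ge0 //; apply: sumr_ge0 => t _; rewrite mulr_ge0.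
have f0 s : 0 <= f s.
  rewrite -oppr_le0 -sub0r.
  apply: (max_principle (f := fun t => 0 - f t) tM cM bC) => t tC.
    by rewrite avgB avg_cst //; have := fC _ tC; have := g0 t; lra.
  by rewrite fNC // sub0r oppr_le0.
pose u k s := \sum_(0 <= n < k) a n s.
have uS k s : u k.+1 s = g s + (s \in C)%:R * avg M (u k) s.
  rewrite /u big_nat_recl // a0; congr (_ + _).
  rewrite /avg; under [in RHS]eq_bigr do rewrite mulr_sumr.
  rewrite exchange_big mulr_sumr; apply: eq_bigr => n _; exact: aS.
have uf k s : u k s <= f s.
  elim: k s => [|k IHk] s; first by rewrite /u big_geq.
  rewrite uS; have [sC|sC] := boolP (s \in C); last by rewrite mul0r addr0 fNC.
  by rewrite mul1r fC // addrC lerD2r avg_le.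
have ucvg s : cvgn (u^~ s).
  apply: nondecreasing_is_cvgn.
    by apply/nondecreasing_seqP => n; rewrite /u big_nat_recr //= lerDl.
  by exists (f s) => _ [k _ <-].
pose F s := limn (u^~ s).
have FE s : F s = g s + (s \in C)%:R * avg M F s.
  have c1 : (u^~ s @ \oo --> F s)%classic by exact: ucvg.
  have c2 : ((fun k => g s + (s \in C)%:R * avg M (u k) s) @ \oo -->
             g s + (s \in C)%:R * avg M F s)%classic.
    apply: cvgD; first exact: cvg_cst.
    apply: cvgMl_tmp; apply: cvg_big => [|t _]; first exact: add_continuous.
    by apply: cvgMl_tmp; exact: ucvg.
  move: c1; rewrite -cvg_shiftS /=; under eq_fun do rewrite uS.
  by move=> c1; exact: cvg_unique c1 c2.
have Ff : F =1 f.
  apply: (dirichlet_unique tM cM bC) => s sC.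
    by rewrite FE fC // sC mul1r; lra.
  by rewrite FE fNC // (negbTE sC) mul0r addr0.
move=> s; apply: cvg_lim => //.
rewrite (_ : (fun n => _) = EFin \o (u^~ s)); last by apply/funext => n; rewrite /= sumEFin.
apply: cvg_EFin; first by apply: nearW.
rewrite -Ff; exact: ucvg.
Qed.

Lemma exitQ_harmonic M C f t b : trans_mx M -> edge_connected M ->
  b \notin C -> t \notin C -> (forall s, s \in C -> f s = avg M f s) ->
  (forall s, s \notin C -> f s = (s == t)%:R) ->
  forall s, exitQ M C s t = (f s)%:E.
Proof.
move=> tM cM bC tC fC fNC.
apply: (@killed_series M C f (fun s => (s == t)%:R) b (fun n s => pathC M C n s t)) => // s sC.
rewrite (_ : (s == t) = false) ?addr0 ?fC //.
by apply: contraNF tC => /eqP <-.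
Qed.

Lemma exitT_solution M C f b : trans_mx M -> edge_connected M ->
  b \notin C -> (forall s, s \in C -> f s = avg M f s + 1) ->
  (forall s, s \notin C -> f s = 0) -> forall s, exitT M C s = (f s)%:E.
Proof.
move=> tM cM bC fC fNC.
apply: (@killed_series M C f (fun s => (s \in C)%:R) b
  (fun n s => \sum_(u in C) pathC M C n s u)) => //= [s|n s|s sC|s sC].
- have [sC|sC] := boolP (s \in C).
    rewrite (bigD1 s) //= eqxx big1 ?addr0 // => u /andP[_].
    by rewrite eq_sym => /negbTE ->.
  rewrite big1 // => u uC; rewrite (_ : (s == u) = false) //.
  by apply: contraNF sC => /eqP ->.
- rewrite -mulr_sumr /avg exchange_big /=; congr (_ * _).
  by apply: eq_bigr => t _; rewrite mulr_sumr.
- by rewrite sC fC.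
- by rewrite (negbTE sC) fNC.
Qed.

Lemma sum_qset m M C D :
  \sum_(s in C) m s * qset M D s = \sum_(s in C) \sum_(t in D) m s * M s t.
Proof. by apply: eq_bigr => s _; rewrite /qset mulr_sumr. Qed.

(** With [f] the expected exit time, the mass of [C] is the sum of [m s * (f s - avg M f s)] over
    [C]. Since [m] integrates [f] and [avg M f] equally and [f] vanishes off [C], this is the sum of
    [m t * avg M f t] over [t] off [C]: visit lengths weighted by the entrance flow. *)
Lemma KC_mass_over_flow M m C b : trans_mx M -> edge_connected M ->
  invariant_measure M m -> b \notin C -> flow m M C != 0 ->
  KC M m C = ((\sum_(s in C) m s) / flow m M C)%:E.
Proof.
move=> tM cM mM bC fl0.
have [f [fC fNC]] := dirichlet_exists (fun s => (s \in C)%:R) tM cM bC.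
have {}fC s : s \in C -> f s = avg M f s + 1 by move=> sC; rewrite fC // sC.
have {}fNC s : s \notin C -> f s = 0 by move=> sC; rewrite fNC // (negbTE sC).
have inE : \sum_(t in ~: C) m t * qset M C t = flow m M C.
  rewrite sum_qset -(flow_balance C tM mM).
  by apply: eq_bigl => s; rewrite finset.inE.
rewrite /KC; under eq_bigr do rewrite (exitT_solution tM cM bC fC fNC) -EFinM.
rewrite sumEFin; congr (_%:E).
rewrite /nuC inE; under eq_bigr do rewrite mulrAC.
rewrite -mulr_suml; congr (_ / _).
have -> : \sum_(s in C) m s = \sum_(s in C) m s * (f s - avg M f s).
  by apply: eq_bigr => s sC; rewrite fC // addrAC subrr add0r mulr1.
transitivity (\sum_s (\sum_(t in ~: C) m t * M t s) * f s).
  by rewrite -(sum_memC C) [X in _ = _ + X]big1 ?addr0 // => s sC; rewrite fNC ?mulr0.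
under eq_bigr do rewrite mulr_suml.
rewrite exchange_big /=; under eq_bigr => t _.
  rewrite (_ : \sum_(s : S) _ = m t * avg M f t); last first.
    by rewrite /avg mulr_sumr; apply: eq_bigr => s _; rewrite mulrA.
  over.
under [RHS]eq_bigr do rewrite mulrBr.
rewrite sumrB.
rewrite (_ : \sum_(s in C) m s * f s = \sum_s m s * f s); last first.
  by rewrite -(sum_memC C) [X in _ = _ + X]big1 ?addr0 // => s sC; rewrite fNC ?mulr0.
rewrite -(invariant_avg f mM) -(sum_memC C) addrAC subrr add0r.
by apply: eq_bigl => s; rewrite finset.inE.
Qed.

Lemma flow_gt0 M m A a b :
  trans_mx M -> edge_connected M -> (forall s, 0 < m s) ->
  a \in A -> b \notin A -> 0 < flow m M A.
Proof.
move=> [M0 _] cM m0 aA bA; have [s [t [sA tA Mst]]] := cM A a b aA bA.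
have ge0 x y : 0 <= m x * M x y by rewrite mulr_ge0 // ltW.
rewrite /flow (bigD1 s) //= ltr_pwDl //; last first.
  by apply: sumr_ge0 => x _; apply: sumr_ge0 => y _.
rewrite (bigD1 t) //= ltr_pwDl ?mulr_gt0 //.
by apply: sumr_ge0 => y _.
Qed.

Lemma flow_scale_lo M m mu A a :
  trans_mx M -> (forall s, a * mu s <= m s) -> a * flow mu M A <= flow m M A.
Proof.
move=> [M0 _] am; rewrite /flow mulr_sumr; apply: ler_sum => s _.
by rewrite mulr_sumr; apply: ler_sum => t _; rewrite mulrA ler_wpM2r.
Qed.

Lemma flow_scale_hi M m mu A a :
  trans_mx M -> (forall s, m s <= a * mu s) -> flow m M A <= a * flow mu M A.
Proof.
move=> [M0 _] am; rewrite /flow mulr_sumr; apply: ler_sum => s _.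
by rewrite mulr_sumr; apply: ler_sum => t _; rewrite mulrA ler_wpM2r.
Qed.

Lemma harmonic_range M C f b :
  trans_mx M -> edge_connected M -> b \notin C ->
  (forall s, s \in C -> f s = avg M f s) ->
  (forall s, s \notin C -> 0 <= f s <= 1) -> forall s, 0 <= f s <= 1.
Proof.
move=> tM cM bC fC fNC s; apply/andP; split.
  rewrite -oppr_le0 -sub0r.
  apply: (max_principle (f := fun t => 0 - f t) tM cM bC) => t tC.
    by rewrite avgB avg_cst // -fC.
  by have := fNC _ tC; lra.
rewrite -subr_le0; apply: (max_principle (f := fun t => f t - 1) tM cM bC) => t tC.
  by rewrite avgB avg_cst // -fC.
by have := fNC _ tC; lra.
Qed.

End Chains.

(** * Elementary inequalities between powers of [1 + x] and [1 - x] *)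

Section Numerics.
Variable R : realType.

Lemma bernoulli_sub (x : R) k : 0 <= x <= 1 -> 1 - k%:R * x <= (1 - x) ^+ k.
Proof.
move=> /andP[x0 x1]; elim: k => [|k IHk]; first by rewrite mul0r subr0 expr0.
have kx : 0 <= k%:R * (x * x) by rewrite mulr_ge0 ?mulr_ge0.
have := ler_wpM2r (_ : 0 <= 1 - x) IHk; rewrite exprSr => H.
by apply: le_trans (H _); [rewrite -natr1; lra | lra].
Qed.

Lemma pow_ratio_bound (x : R) k : 0 <= x <= 1 -> (1 + x) ^+ k * (1 - x) ^+ k <= 1.
Proof. by move=> /andP[x0 x1]; rewrite -exprMn; apply: exprn_ile1; nra. Qed.

(** Converts [x * 2 ^+ n < 3 / 2] into [n * x < 9 / 16]. It is an equality at 3 and fails at 2, so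
    [n = 2] is treated by hand below. *)
Lemma leq_mul8_exp2 n : (3 <= n)%N -> (8 * n <= 3 * 2 ^ n)%N.
Proof. by elim: n => // n IHn; rewrite expnS; case: (ltngtP n 2) => [||->] //; lia. Qed.

(** Here [x] is [gam] and [k] counts the rows already replaced. The powers of [1 - x] are at least
    7/16 by Bernoulli, and [9 * 49 / 256 > 1]. *)
Lemma pow_quotient_lt (x : R) n k : (2 <= n)%N -> 0 < x -> x * 2 ^+ n < 3 / 2 ->
  (k < n)%N -> (1 + x) ^+ k <= n%:R ^+ 2 * (1 - x) ^+ k.+1.
Proof.
move=> n2 x0 xn kn; have [n3|] := leqP 3 n; last first.
  move=> n3; have nE : n = 2%N by lia.
  rewrite {n2 n3}nE in xn kn *; case: k kn => [|[|//]] _; rewrite ?expr0 ?expr1; nra.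
have nx : n%:R * x < 9 / 16.
  have : (8 * n)%:R <= (3 * 2 ^ n)%:R :> R by rewrite ler_nat leq_mul8_exp2.
  rewrite !natrM natrX => H; have := ler_wpM2r (ltW x0) H; lra.
have x1 : 0 <= x <= 1.
  by have : 3 <= n%:R :> R; [rewrite ler_nat|nra].
have low j : (j <= n)%N -> 7 / 16 <= (1 - x) ^+ j.
  move=> jn; apply: le_trans (bernoulli_sub j x1).
  have : j%:R * x <= n%:R * x by rewrite ler_wpM2r ?ler_nat ?(ltW x0).
  lra.
have p := low _ (ltnW kn); have p1 := low _ kn.
have n9 : 9 <= n%:R ^+ 2 :> R by rewrite -natrX ler_nat; lia.
have p0 : 0 < (1 - x) ^+ k by lra.
rewrite -(ler_pM2r p0); apply: le_trans (pow_ratio_bound k x1) _.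
have : 49 / 256 <= (1 - x) ^+ k.+1 * (1 - x) ^+ k by nra.
by rewrite -mulrA; nra.
Qed.

(** For all [n] rows the last power is only bounded below by 1/4, and [9 * 7 / 64] falls just short
    of 1; hence the factor 2, which reappears in [c]. *)
Lemma pow_quotient_le (x : R) n : (2 <= n)%N -> 0 < x -> x * 2 ^+ n < 3 / 2 ->
  (1 + x) ^+ n <= (2 * n%:R ^+ 2) * (1 - x) ^+ n.+1.
Proof.
move=> n2 x0 xn; have [n3|] := leqP 3 n; last first.
  move=> n3; have nE : n = 2%N by lia.
  rewrite {n2 n3}nE in xn *; have y : 5 / 8 <= 1 - x by lra.
  have -> : 1 + x = 2 - (1 - x) by lra.
  have : 1 - x <= 1 by lra.
  move: (1 - x) y => {xn x0}y y0 y1.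
  have : 25 / 64 * y <= y ^+ 3 by rewrite !exprS expr0; nra.
  by nra.
have nx : n%:R * x < 9 / 16.
  have : (8 * n)%:R <= (3 * 2 ^ n)%:R :> R by rewrite ler_nat leq_mul8_exp2.
  rewrite !natrM natrX => H; have := ler_wpM2r (ltW x0) H; lra.
have n3R : 3 <= n%:R :> R by rewrite ler_nat.
have x1 : 0 <= x <= 1 by nra.
have p : 7 / 16 <= (1 - x) ^+ n by apply: le_trans (bernoulli_sub n x1); lra.
have p1 : 1 / 4 <= (1 - x) ^+ n.+1.
  have := ler_wpM2r (ltW x0) n3R.
  by move=> ?; apply: le_trans (bernoulli_sub _ x1); rewrite -(natr1 n); lra.
have n9 : 9 <= n%:R ^+ 2 :> R by rewrite -natrX ler_nat; lia.
have p0 : 0 < (1 - x) ^+ n by lra.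
rewrite -(ler_pM2r p0); apply: le_trans (pow_ratio_bound n x1) _.
have : 7 / 64 <= (1 - x) ^+ n.+1 * (1 - x) ^+ n by nra.
by rewrite -mulrA; nra.
Qed.

End Numerics.

(** * Replacing all rows *)

Section RowReplacement.
Variables (R : realType) (S : finType) (q qh : S -> S -> R) (mu : S -> R).
Variables (beta eps z gam : R).
Hypotheses (tq : trans_mx q) (cq : edge_connected q) (tqh : trans_mx qh).
Hypotheses (mu_gt0 : forall s, 0 < mu s) (muq : invariant_measure q mu).
Hypotheses (z_gt0 : 0 < z).
Hypothesis zq : forall (A : {set S}) a b, a \in A -> b \notin A -> z <= flow mu q A.
Hypotheses (beta_gt0 : 0 < beta) (eps_gt0 : 0 < eps).
Hypotheses (gamE : gam = 3 / 2 * beta) (gam_lt1 : gam < 1).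
Hypothesis q_qh : forall s, row_close beta (eps * z / mu s) q qh s.
Hypothesis eps_small : #|S|%:R ^+ 4 * eps <= beta / 2.
Hypothesis gam_small : forall k, (k < #|S|)%N ->
  (1 + gam) ^+ k <= #|S|%:R ^+ 2 * (1 - gam) ^+ k.+1.

Implicit Types (A B C : {set S}) (m f : S -> R) (c : R).

Definition replace_rows (A : {set S}) s t := if s \in A then qh s t else q s t.

Lemma replace_rows_trans A : trans_mx (replace_rows A).
Proof.
case: tq tqh => [q0 q1] [qh0 qh1]; split=> [s t|s]; first by rewrite /replace_rows; case: ifP.
by rewrite -[RHS](if_same (s \in A)) -{1}(qh1 s) -(q1 s) /replace_rows; case: ifP.
Qed.

(** The measure stays [mu]. The relative errors cost [beta] times the flow; the at most [#|S| ^ 2]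
    additive errors [eps * z] cost [beta / 2] times the flow, because [z] is below every flow. Their
    sum is [gam]. *)
Lemma flow_replace_rows A (B : {set S}) a b : a \in B -> b \notin B ->
  (1 - gam) * flow mu q B <= flow mu (replace_rows A) B <= (1 + gam) * flow mu q B.
Proof.
move=> aB bB; have zB := zq aB bB.
suff : `|flow mu (replace_rows A) B - flow mu q B| <= gam * flow mu q B.
  by move=> /ler_normlP[]; lra.
have ez0 : 0 <= eps * z by rewrite mulr_ge0 ?ltW.
apply: (@le_trans _ _ (\sum_(s in B) \sum_(t | t \notin B) (beta * (mu s * q s t) + eps * z))).
  rewrite /flow -sumrB; apply: le_trans (ler_norm_sum _ _ _) _.
  apply: ler_sum => s _; rewrite -sumrB; apply: le_trans (ler_norm_sum _ _ _) _.
  apply: ler_sum => t _; rewrite -mulrBr normrM gtr0_norm // /replace_rows.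
  case: ifP => _; last first.
    have [q0 _] := tq; rewrite subrr normr0 mulr0; apply: addr_ge0 => //.
    by apply: mulr_ge0; [exact: ltW | apply: mulr_ge0 => //; exact: ltW].
  apply: le_trans (ler_wpM2l (ltW (mu_gt0 s)) (q_qh s t)) _.
  by rewrite mulrDr mulrCA [X in _ + X]mulrC divfK ?gt_eqF.
under eq_bigr do rewrite big_split /= -mulr_sumr.
rewrite big_split /= -mulr_sumr -/(flow mu q B) gamE.
suff : \sum_(s in B) \sum_(t | t \notin B) eps * z <= beta / 2 * flow mu q B by lra.
apply: (@le_trans _ _ (\sum_(s : S) \sum_(t : S) eps * z)).
  rewrite [leRHS](bigID (mem B)) /= -[leLHS]addr0 lerD //; last first.
    by apply: sumr_ge0 => s _; apply: sumr_ge0.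
  apply: ler_sum => s _; rewrite [leRHS](bigID (fun t => t \notin B)) /= lerDl.
  exact: sumr_ge0.
rewrite !sumr_const -[_ *+ _ *+ _]mulr_natl -[eps * z *+ _]mulr_natl.
have N1 : 1 <= #|S|%:R :> R by rewrite ler1n; apply/card_gt0P; exists a.
have N2 : #|S|%:R ^+ 2 * eps <= beta / 2.
  apply: le_trans eps_small; rewrite ler_wpM2r ?(ltW eps_gt0) //.
  by rewrite -[leRHS]/(#|S|%:R ^+ (2 + 2)) exprD ler_peMr ?exprn_ge0 ?exprn_ege1.
rewrite mulrA -expr2 mulrA; apply: (@le_trans _ _ (beta / 2 * z)).
  by rewrite ler_wpM2r ?(ltW z_gt0).
by rewrite ler_wpM2l // divr_ge0 // ltW.
Qed.

(** Every cut keeps a positive flow, hence a transition across it. *)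
Lemma replace_rows_connected A : edge_connected (replace_rows A).
Proof.
move=> B a b aB bB; apply: contrapT => noedge.
have /andP[lo _] := flow_replace_rows A aB bB.
have : 0 < (1 - gam) * flow mu q B.
  by rewrite mulr_gt0 ?subr_gt0 // (lt_le_trans z_gt0 (zq aB bB)).
move=> /lt_le_trans/(_ lo); suff -> : flow mu (replace_rows A) B = 0 by rewrite ltxx.
apply: big1 => s sB; apply: big1 => t tB; apply/eqP; rewrite mulf_eq0 gt_eqF //=.
rewrite eq_le (proj1 (replace_rows_trans A)) andbT leNgt; apply/negP => st.
by apply: noedge; exists s, t.
Qed.

(** Provides what the one-row lemmas ask of an intermediate matrix. They require a factor
    [#|S| ^ 2], and the spread between [m] and [mu] costs another one through [gam_small]; this
    explains the fourth power in [eps_small]. *)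
Lemma replace_rows_flow_bound A m c : (#|A| < #|S|)%N -> 0 < c ->
  (forall v, (1 - gam) ^+ #|A| * (c * mu v) <= m v <= (1 + gam) ^+ #|A| * (c * mu v)) ->
  exists z', [/\ 0 < z',
    forall (B : {set S}) a b, a \in B -> b \notin B -> z' <= flow m (replace_rows A) B &
    forall w, #|S|%:R * (#|S|%:R * (eps * z / mu w * m w)) <= (gam - beta) * z'].
Proof.
move=> AS c0 mc; set k := #|A| in AS mc *.
have g0 : 0 < 1 - gam by rewrite subr_gt0.
(* The factor [(1 - gam) ^+ k * c] pays for passing from [mu] to [m], the other [1 - gam] for the
   replaced rows. *)
exists ((1 - gam) ^+ k * c * ((1 - gam) * z)); split.
- by rewrite !mulr_gt0 ?exprn_gt0.
- move=> B a b aB bB.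
  apply: le_trans (@flow_scale_lo _ _ _ m mu B ((1 - gam) ^+ k * c) (replace_rows_trans A) _).
    rewrite ler_wpM2l ?mulr_ge0 ?exprn_ge0 ?(ltW c0) ?(ltW g0) //.
    have /andP[lo _] := flow_replace_rows A aB bB; apply: le_trans lo.
    by rewrite ler_pM2l // (zq aB bB).
  by move=> v; rewrite -mulrA; case/andP: (mc v).
- move=> w; have /andP[_ hi] := mc w.
  have cz : 0 < c * z by rewrite mulr_gt0.
  apply: (@le_trans _ _ (#|S|%:R ^+ 2 * (eps * (1 + gam) ^+ k) * (c * z))).
    rewrite [leLHS]mulrA -expr2 -[leRHS]mulrA ler_wpM2l ?exprn_ge0 //.
    apply: (@le_trans _ _ (eps * z / mu w * ((1 + gam) ^+ k * (c * mu w)))).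
      by rewrite ler_wpM2l // ltW // divr_gt0 // mulr_gt0.
    rewrite le_eqVlt; apply/orP; left; apply/eqP; field.
    by rewrite gt_eqF.
  have -> : (gam - beta) * ((1 - gam) ^+ k * c * ((1 - gam) * z)) =
            beta / 2 * (1 - gam) ^+ k.+1 * (c * z).
    by rewrite exprS gamE; field.
  rewrite ler_pM2r //.
  apply: (@le_trans _ _ (#|S|%:R ^+ 4 * eps * (1 - gam) ^+ k.+1)); last first.
    by rewrite ler_wpM2r // exprn_ge0 // ltW.
  rewrite [leRHS](_ : _ = #|S|%:R ^+ 2 * (eps * (#|S|%:R ^+ 2 * (1 - gam) ^+ k.+1))); last by ring.
  by rewrite ler_wpM2l ?exprn_ge0 // ler_pM2l // gam_small.
Qed.

Lemma replace_rows_other A w s t : s != w -> replace_rows A s t = replace_rows (A :\ w)%SET s t.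
Proof. by move=> sw; rewrite /replace_rows !finset.inE sw. Qed.

Lemma replace_rows_close A w : w \in A ->
  row_close beta (eps * z / mu w) (replace_rows (A :\ w)%SET) (replace_rows A) w.
Proof. by move=> wA x; rewrite /replace_rows wA !finset.inE eqxx; exact: q_qh. Qed.

Lemma gam_ge_beta : 0 <= beta <= gam. Proof. by have := beta_gt0; rewrite gamE; lra. Qed.

Lemma error_ge0 w : 0 <= eps * z / mu w.
Proof. by rewrite ltW // divr_gt0 // mulr_gt0. Qed.

(** Induction on the size of [A]: restoring row [w] of [q] gives an intermediate matrix with an
    invariant measure [m], and replacing that row costs one more factor. *)
Lemma replace_rows_measure A m' : invariant_measure (replace_rows A) m' ->
  (forall s, 0 <= m' s) -> (exists s, 0 < m' s) ->
  exists2 c, 0 < c & forall v,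
    (1 - gam) ^+ #|A| * (c * mu v) <= m' v <= (1 + gam) ^+ #|A| * (c * mu v).
Proof.
move En : #|A| => n; elim: n A En m' => [|n IHn] A cA m' m'M m'0 [s0 ms0].
  have A0 : A = finset.set0 by apply/eqP; rewrite -cards_eq0 cA.
  have Mq s t : replace_rows A s t = q s t by rewrite /replace_rows A0 finset.inE.
  have {}m'M : invariant_measure q m'.
    by move=> t; rewrite -m'M; apply: eq_bigr => s _; rewrite Mq.
  exists (m' s0 / mu s0) => [|v]; first by rewrite divr_gt0.
  rewrite !expr0 !mul1r.
  (* A row change with zero error yields uniqueness of the invariant measure up to scaling. *)
  have cl0 : row_close 0 0 q q s0.
    by move=> x; rewrite subrr normr0 mul0r addr0.
  have : (1 - 0) * (mu v * m' s0) <= m' v * mu s0 <= (1 + 0) * (mu v * m' s0).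
    apply: (row_change_invariant tq cq muq m'M _ m'0 z_gt0 zq _ cl0) => //.
    - by move=> s; exact: ltW.
    - by rewrite lexx.
    - by rewrite mul0r !mulr0 subrr mul0r.
  rewrite subr0 addr0 !mul1r => /le_anti.
  move=> E; suff -> : m' v = m' s0 / mu s0 * mu v by rewrite lexx.
  apply: (mulIf (lt0r_neq0 (mu_gt0 s0))); rewrite -E; field.
  by rewrite gt_eqF.
have [w wA] : exists w, w \in A by apply/card_gt0P; rewrite cA.
have cA' : #|A :\ w|%SET = n by have := cardsD1 w A; rewrite wA cA; lia.
set A' := (A :\ w)%SET in cA'.
have tM := replace_rows_trans A'; have cM := replace_rows_connected A'.
have [m mM [m0 [x mx]]] := invariant_exists w tM.
have m_gt0 := invariant_pos tM cM mM m0 mx.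
have [c c0 mc] := IHn _ cA' _ mM m0 (ex_intro _ x mx).
have AS : (#|A'| < #|S|)%N by rewrite cA' -cA max_card.
have [|z' [z'0 z'M z'e]] := @replace_rows_flow_bound A' m c AS c0; first by rewrite cA'.
have row := row_change_invariant tM cM mM m'M m0 m'0 z'0 z'M
  (fun s t sw => replace_rows_other A t sw) (replace_rows_close wA) gam_ge_beta
  (error_ge0 w) (z'e w).
have m'_gt0 := invariant_pos (replace_rows_trans A) (replace_rows_connected A) m'M m'0 ms0.
(* This scaling makes [m] agree with [m'] at [w]. *)
exists (c * (m' w / m w)); first by rewrite mulr_gt0 ?divr_gt0.
move=> v; have /andP[lo hi] := row v; have /andP[mlo mhi] := mc v.
have gam0 : 0 <= 1 - gam by rewrite subr_ge0 ltW.
have gam0' : 0 <= 1 + gam by have := beta_gt0; rewrite gamE; lra.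
have mE y k : y ^+ k.+1 * (c * (m' w / m w) * mu v) = y * (y ^+ k * (c * mu v) * m' w) / m w.
  by rewrite exprS; field; rewrite gt_eqF.
rewrite !mE ler_pdivrMr // ler_pdivlMr //; apply/andP; split.
  by apply: le_trans lo; rewrite ler_wpM2l // ler_wpM2r.
by apply: le_trans hi _; rewrite ler_wpM2l // ler_wpM2r.
Qed.

(** Telescoping over single replacements, with [k] the exit function of the intermediate matrix. *)
Lemma replace_rows_exit A (C : {set S}) t b f f' : b \notin C ->
  (forall s, s \in C -> f s = avg q f s) ->
  (forall s, s \in C -> f' s = avg (replace_rows A) f' s) ->
  (forall s, s \notin C -> f s = (s == t)%:R) ->
  (forall s, s \notin C -> f' s = (s == t)%:R) ->
  forall s, `|f' s - f s| <= #|A|%:R * (gam / (1 - gam)).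
Proof.
move=> bC fC f'C fNC f'NC; move En : #|A| => n.
elim: n A En f' f'C f'NC => [|n IHn] A cA f' f'C f'NC s.
  have A0 : A = finset.set0 by apply/eqP; rewrite -cards_eq0 cA.
  rewrite (dirichlet_unique (f := f') (g := f) tq cq bC) ?subrr ?normr0 ?mul0r // => x xC.
    rewrite -fC // f'C // subrr; apply/eqP; rewrite subr_eq0; apply/eqP.
    by apply: eq_bigr => y _; rewrite /replace_rows A0 finset.inE.
  by rewrite f'NC // fNC.
have [w wA] : exists w, w \in A by apply/card_gt0P; rewrite cA.
have cA' : #|A :\ w|%SET = n by have := cardsD1 w A; rewrite wA cA; lia.
set A' := (A :\ w)%SET in cA'.
have tM := replace_rows_trans A'; have cM := replace_rows_connected A'.
have [m mM [m0 [x mx]]] := invariant_exists w tM.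
have [c c0 mc] := replace_rows_measure mM m0 (ex_intro _ x mx).
have AS : (#|A'| < #|S|)%N by rewrite cA' -cA max_card.
have [z' [z'0 z'M z'e]] := replace_rows_flow_bound AS c0 mc.
(* The factor for [y \notin C] removes the source on [C] and leaves the boundary values alone. *)
have [k [kC kNC]] := dirichlet_exists (fun y => (y == t)%:R * (y \notin C)%:R) tM cM bC.
have {}kC y : y \in C -> k y = avg (replace_rows A') k y.
  by move=> yC; rewrite kC // yC mulr0 addr0.
have {}kNC y : y \notin C -> k y = (y == t)%:R.
  by move=> yC; rewrite kNC // yC mulr1.
have k01 : forall y, 0 <= k y <= 1.
  apply: (harmonic_range tM cM bC kC) => y yC; rewrite kNC //.
  by case: eqP; rewrite ?ler01 ?lexx.
have kNC' y : y \notin C -> f' y = k y by move=> yC; rewrite f'NC // kNC.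
have row := row_change_exit tM cM (replace_rows_trans A) mM m0 z'0 z'M
  (fun s t sw => replace_rows_other A t sw) (replace_rows_close wA) gam_ge_beta
  gam_lt1 (error_ge0 w) (z'e w) bC kC f'C kNC' k01 s.
have := IHn _ cA' _ kC kNC s; rewrite -natr1 mulrDl mul1r => ih.
rewrite -[f' s - f s](subrKA (k s)); apply: le_trans (ler_normD _ _) _.
by rewrite addrC lerD.
Qed.

End RowReplacement.

(** * From closeness to row errors, and the two estimates *)

Lemma proper_memC (S : finType) (A : {set S}) : A != finset.set0 -> A != [set: S] ->
  exists a b, a \in A /\ b \notin A.
Proof.
move=> /set0Pn[a aA] AT; apply: contrapT => H; case/eqP: AT; apply/setP => x.
by rewrite finset.inE; apply/negPn/negP => xA; apply: H; exists a, x.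
Qed.

(** With two states a singleton is an admissible cut, so the minimum is attained at some cut instead
    of being the default [+oo], and its flow is positive. *)
Lemma zeta_flow (R : realType) (S : finType) (q : S -> S -> R) (mu : S -> R) :
  (2 <= #|S|)%N -> trans_mx q -> edge_connected q -> (forall s, 0 < mu s) ->
  exists z, [/\ zeta q mu = z%:E, 0 < z &
    forall (A : {set S}) a b, a \in A -> b \notin A -> z <= flow mu q A].
Proof.
move=> S2 tq cq mu0.
have flowE (A : {set S}) : \sum_(s in A) mu s * qset q (~: A) s = flow mu q A.
  rewrite sum_qset; apply: eq_bigr => s _; apply: eq_bigl => t.
  by rewrite finset.inE.
have [s0 s0S] : exists s0 : S, s0 \in [set: S]%SET by apply/card_gt0P; rewrite cardsT; lia.
have pr : ([set s0]%SET != finset.set0) && ([set s0]%SET != [set: S]%SET).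
  apply/andP; split; first by apply/set0Pn; exists s0; rewrite finset.set11.
  by apply: contraTneq S2 => E; rewrite -ltnNge -cardsT -E cards1.
rewrite /zeta (bigmin_eq_arg _ [set s0]%SET) //; last by move=> A _; exact: leey.
case: arg_minP => // C /andP[C0 CT] Cmin; eexists; split; first reflexivity.
  by have [a [b [aC bC]]] := proper_memC C0 CT; rewrite flowE; exact: flow_gt0 aC bC.
move=> A a b aA bA; have := Cmin A; rewrite lee_fin !flowE; apply.
apply/andP; split; first by apply/set0Pn; exists a.
by apply: contraNneq bA => ->; rewrite finset.inE.
Qed.

(** The term [n = 1] of the sum is already [#|S|]. *)
Lemma leq_card_Lconst (S : finType) : (2 <= #|S|)%N -> (#|S| <= Lconst S)%N.
Proof.
move=> S2; rewrite /Lconst big_ltn // exp1n muln1 bin1; exact: leq_addr.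
Qed.

(** If neither case of closeness applies, both entries lie between 0 and [eps * z / mu s], so their
    difference is below that bound. *)
Lemma eb_close_row_close (R : realType) (S : finType) (q qh : S -> S -> R)
    (mu : S -> R) (beta eps z : R) :
  trans_mx q -> trans_mx qh -> (forall s, 0 < mu s) -> 0 <= beta -> 0 <= eps * z ->
  zeta q mu = z%:E -> eb_close eps beta q qh mu ->
  forall s, row_close beta (eps * z / mu s) q qh s.
Proof.
move=> [q0 _] [qh0 _] mu0 beta0 ez0 zE cl s t.
have := cl s t; rewrite zE -EFinM !lee_fin.
have e0 : 0 <= eps * z / mu s by rewrite divr_ge0 // ltW.
have [good H|bad _] := boolP ((eps * z <= mu s * q s t) || (eps * z <= mu s * qh s t)).
  have [qst] := H (elimT orP good); rewrite -(ler_pM2r qst) -{2}(gtr0_norm qst) -normrM.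
  rewrite mulrBl mul1r divfK ?gt_eqF // distrC => /le_trans; apply.
  by rewrite lerDl.
move: bad; rewrite negb_or -!ltNge => /andP[b1 b2].
have {}b1 : q s t < eps * z / mu s by rewrite ltr_pdivlMr // mulrC.
have {}b2 : qh s t < eps * z / mu s by rewrite ltr_pdivlMr // mulrC.
have bq := mulr_ge0 beta0 (q0 s t).
by rewrite ler_norml; have := q0 s t; have := qh0 s t; lra.
Qed.

Theorem theorem3 (R : realType) (S : finType) (beta epsilon : R)
  (q qh : S -> S -> R) (mu muh : S -> R) :
  (2 <= #|S|)%N ->
  0 < beta -> beta < 1 / (2 ^+ #|S|) ->
  0 < epsilon -> epsilon < beta * (1 - beta) / ((Lconst S)%:R * (#|S| ^ 4)%:R) ->
  trans_mx q -> irreducible q -> stationary q mu ->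
  trans_mx qh -> stationary qh muh ->
  eb_close epsilon beta q qh mu ->
  let c : R := (2 * #|S| ^ 2)%:R in
  forall C : {set S}, C != finset.set0 -> C != [set: S] ->
    (forall s, s \in C -> forall t, t \notin C ->
       (`| exitQ q C s t - exitQ qh C s t | < (12 * beta * (Lconst S)%:R)%:E)%E)
    /\ ((c^-1)%:E * KC q mu C <= KC qh muh C)%E
    /\ (KC qh muh C <= c%:E * KC q mu C)%E.
Proof.
move=> S2 beta0 beta_lt eps0 eps_lt tq irrq [mu0 [mu1 muq]] tqh [muh0 [muh1 muhq]] cl c C C0 CT.
have cq := irreducible_connected tq irrq.
have pos_of_sum (m : S -> R) : (forall s, 0 <= m s) -> \sum_s m s = 1 -> exists s, 0 < m s.
  move=> m0 m1; apply: contrapT => H; have := oner_neq0 R; rewrite -m1 big1 ?eqxx // => s _.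
  apply/eqP; rewrite eq_le m0 andbT leNgt; apply/negP => ms; apply: H; by exists s.
have [s0 ms0] := pos_of_sum _ mu0 mu1.
have mu_gt0 := invariant_pos tq cq muq mu0 ms0.
have [z [zE z0 zq]] := zeta_flow S2 tq cq mu_gt0.
have q_qh := eb_close_row_close tq tqh mu_gt0 (ltW beta0) (ltW (mulr_gt0 eps0 z0)) zE cl.
pose gam := 3 / 2 * beta.
have SR : 2 <= #|S|%:R :> R by rewrite ler_nat.
have S0 : 0 < #|S|%:R :> R by lra.
have SL : #|S|%:R <= (Lconst S)%:R :> R by rewrite ler_nat leq_card_Lconst.
have pow0 : 0 < 2 ^+ #|S| :> R by rewrite exprn_gt0.
have beta_pow : beta * 2 ^+ #|S| < 1 by rewrite -ltr_pdivlMr.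
have beta4 : beta < 1 / 4.
  have : 2 ^+ 2 <= 2 ^+ #|S| :> R by rewrite ler_eXn2l // ltr1n.
  by nra.
have gam0 : 0 < gam by rewrite /gam; lra.
have gam1 : gam < 3 / 8 by rewrite /gam; lra.
have gam_lt1 : gam < 1 by lra.
have gam_pow : gam * 2 ^+ #|S| < 3 / 2 by rewrite /gam; lra.
(* Uses [1 - beta < 1] and [Lconst S >= 2]. *)
have eps_small : #|S|%:R ^+ 4 * epsilon <= beta / 2.
  have N4 : 0 < #|S|%:R ^+ 4 :> R by rewrite exprn_gt0.
  have L0 : 0 < (Lconst S)%:R :> R by lra.
  move: eps_lt; rewrite natrX ltr_pdivlMr ?mulr_gt0 // => H.
  have : 0 < #|S|%:R ^+ 4 * epsilon by rewrite mulr_gt0.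
  by nra.
have gam_small k := pow_quotient_lt (k := k) S2 gam0 gam_pow.
have qhE A s t : A = [set: S]%SET -> replace_rows q qh A s t = qh s t.
  by move=> ->; rewrite /replace_rows finset.inE.
have avgE f s : avg (replace_rows q qh [set: S]%SET) f s = avg qh f s.
  by apply: eq_bigr => t _; rewrite qhE.
have cqh : edge_connected qh.
  move=> A a b aA bA; have [s [t [sA tA]]] := replace_rows_connected tq tqh mu_gt0 z0
    zq beta0 eps0 erefl gam_lt1 q_qh eps_small [set: S]%SET aA bA.
  by rewrite qhE // => st; exists s, t.
have [a [b [aC bC]]] := proper_memC C0 CT.
split=> [s sC t tC|].
  have solE (M : S -> S -> R) : trans_mx M -> edge_connected M ->
      exists f, (forall s, s \in C -> f s = avg M f s) /\
        (forall s, s \notin C -> f s = (s == t)%:R).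
    move=> tM cM; have [f [fC fNC]] := dirichlet_exists (fun y => (y == t)%:R) tM cM bC.
    exists f; split=> // y yC; rewrite fC // (_ : (y == t) = false) ?addr0 //.
    by apply: contraNF tC => /eqP <-.
  have [f [fC fNC]] := solE _ tq cq; have [f' [f'C f'NC]] := solE _ tqh cqh.
  rewrite (exitQ_harmonic tq cq bC tC fC fNC) (exitQ_harmonic tqh cqh bC tC f'C f'NC).
  rewrite -EFinB abse_EFin lte_fin distrC.
  have {}f'C y : y \in C -> f' y = avg (replace_rows q qh [set: S]%SET) f' y.
    by move=> yC; rewrite avgE f'C.
  apply: le_lt_trans (replace_rows_exit tq cq tqh mu_gt0 muq z0 zq beta0 eps0 erefl gam_lt1
    q_qh eps_small gam_small bC fC f'C fNC f'NC s) _.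
  (* Since [gam < 3 / 8], [gam / (1 - gam)] is at most
     [(3 / 2) / (5 / 8) * beta = 12 / 5 * beta]. *)
  rewrite cardsT; apply: (@le_lt_trans _ _ (#|S|%:R * (12 / 5 * beta))).
    rewrite ler_wpM2l // ler_pdivrMr ?subr_gt0 // -/gam /gam; nra.
  have : #|S|%:R * beta <= (Lconst S)%:R * beta by rewrite ler_wpM2r // ltW.
  have : 0 < (Lconst S)%:R * beta by rewrite mulr_gt0 //; lra.
  by lra.
have muhR : invariant_measure (replace_rows q qh [set: S]%SET) muh.
  by move=> t; rewrite -muhq; apply: eq_bigr => s _; rewrite qhE.
have [d d0 muh_mu] := replace_rows_measure tq cq tqh mu_gt0 muq z0 zq beta0 eps0 erefl
  gam_lt1 q_qh eps_small gam_small muhR muh0 (pos_of_sum _ muh0 muh1).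
have : (1 - gam) * flow mu q C <= flow mu qh C <= (1 + gam) * flow mu q C.
  have := flow_replace_rows tq mu_gt0 z0 zq beta0 eps0 erefl q_qh eps_small [set: S]%SET aC bC.
  by rewrite (_ : flow mu (replace_rows _ _ _) C = flow mu qh C) //;
    apply: eq_bigr => s _; apply: eq_bigr => t _; rewrite qhE.
move=> /andP[fl_lo fl_hi]; rewrite cardsT in muh_mu.
(* [muh] lies between [lo * mu] and [hi * mu]; the unknown scale [d] cancels in [hi / lo]. *)
set lo := (1 - gam) ^+ #|S| * d; set hi := (1 + gam) ^+ #|S| * d.
have muh_lo s : lo * mu s <= muh s by rewrite -mulrA; case/andP: (muh_mu s).
have muh_hi s : muh s <= hi * mu s by rewrite -mulrA; case/andP: (muh_mu s).
have lo0 : 0 < lo by rewrite mulr_gt0 ?exprn_gt0 ?subr_gt0.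
have hi0 : 0 < hi by rewrite mulr_gt0 ?exprn_gt0 // addr_gt0.
have F0 : 0 < flow mu q C by exact: flow_gt0 aC bC.
have Fh_lo : lo * (1 - gam) * flow mu q C <= flow muh qh C.
  apply: le_trans (flow_scale_lo _ tqh muh_lo); rewrite -mulrA.
  by rewrite ler_pM2l.
have Fh_hi : flow muh qh C <= hi * (1 + gam) * flow mu q C.
  apply: le_trans (flow_scale_hi _ tqh muh_hi) _; rewrite -mulrA.
  by rewrite ler_pM2l.
have Fh0 : 0 < flow muh qh C.
  apply: lt_le_trans Fh_lo; rewrite mulr_gt0 // mulr_gt0 //.
  by rewrite subr_gt0.
have W0 : 0 < \sum_(s in C) mu s.
  by rewrite (bigD1 a) //= ltr_pwDl // sumr_ge0 // => s _; exact: ltW.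
have Wh_lo : lo * \sum_(s in C) mu s <= \sum_(s in C) muh s.
  by rewrite mulr_sumr; apply: ler_sum => s _.
have Wh_hi : \sum_(s in C) muh s <= hi * \sum_(s in C) mu s.
  by rewrite mulr_sumr; apply: ler_sum => s _.
rewrite (KC_mass_over_flow tq cq muq bC) ?gt_eqF //.
rewrite (KC_mass_over_flow tqh cqh muhq bC) ?gt_eqF //.
rewrite -!EFinM !lee_fin.
have cE : c = 2 * #|S|%:R ^+ 2 by rewrite /c natrM natrX.
have c0 : 0 < c by rewrite cE mulr_gt0 ?exprn_gt0.
have hilo : hi <= c * (lo * (1 - gam)).
  have -> : c * (lo * (1 - gam)) = 2 * #|S|%:R ^+ 2 * (1 - gam) ^+ #|S|.+1 * d.
    by rewrite /lo cE (exprSr _ #|S|); ring.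
  by rewrite ler_pM2r // pow_quotient_le.
(* The lower bound on the visit length reduces to [hilo] because [(1 - gam) * (1 + gam) <= 1]. *)
have hilo' : hi * (1 + gam) <= c * lo.
  apply: (@le_trans _ _ (c * (lo * (1 - gam)) * (1 + gam))).
    by rewrite ler_pM2r //; lra.
  have g1 : (1 - gam) * (1 + gam) <= 1 by nra.
  rewrite [leLHS](_ : _ = c * lo * ((1 - gam) * (1 + gam))); last by ring.
  by apply: ler_piMr => //; rewrite ltW // mulr_gt0.
(* What remains is arithmetic of positive reals, [W / F] and [Wh / Fh] being the two visit
   lengths. *)
move: (flow mu q C) (flow muh qh C) (\sum_(s in C) mu s) (\sum_(s in C) muh s)
  F0 Fh0 W0 Fh_lo Fh_hi Wh_lo Wh_hi => F Fh W Wh F0 Fh0 W0 Fh_lo Fh_hi Wh_lo Wh_hi.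
clearbody lo hi c gam.
have WF0 : 0 < W * F by rewrite mulr_gt0.
split.
  rewrite -(ler_pM2l c0) mulrA mulfV ?gt_eqF // mul1r ler_pdivrMr //.
  rewrite [leRHS](_ : _ = c * Wh * F / Fh); last by ring.
  rewrite ler_pdivlMr //.
  have := ler_wpM2l (ltW W0) Fh_hi; have := ler_wpM2l (ltW WF0) hilo'.
  have := ler_wpM2l (ltW (mulr_gt0 c0 F0)) Wh_lo.
  by lra.
rewrite ler_pdivrMr // [leRHS](_ : _ = c * W * Fh / F); last by ring.
rewrite ler_pdivlMr //.
have := ler_wpM2l (ltW F0) Wh_hi; have := ler_wpM2l (ltW WF0) hilo.
have := ler_wpM2l (ltW (mulr_gt0 c0 W0)) Fh_lo.
by lra.
Qed.
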